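(* Let $G$ be a countably infinite cancellative amenable semigroup and let $(F_n)$ be a F{\o}lner sequence in $G$. Then the set $\mathcal N((F_n))$ of $(F_n)$-normal elements is of first Baire category in $\{0,1\}^G$.
   Context: $\{0,1\}^G$ carries the product topology. A semigroup $G$ is (two-sided) cancellative if $ab=ac\Rightarrow b=c$ and $ba=ca\Rightarrow b=c$. For $g\in G$, $F\subset G$: $g^{-1}F=\{h\in G: gh\in F\}$. A sequence $(F_n)$ of (nonempty) finite subsets of $G$ is a (left) F{\o}lner sequence if $\lim_n |F_n\cap g^{-1}F_n|/|F_n|=1$ for every $g\in G$. Amenable means (left) amenable (for such $G$: a left F{\o}lner sequence exists). For nonempty finite $K\subset G$, $B\in\{0,1\}^K$, $x\in\{0,1\}^G$ and finite $F\subset G$ put $\mathsf N(B,x,F)=|\{g\in G\cup\{e\}: (\forall h\in K)\ hg\in F\text{ and }x_{hg}=B(h)\}|$, where $e$ is a formal identity added if $G$ lacks one. An element $x\in\{0,1\}^G$ is $(F_n)$-normal if $\lim_n\frac1{|F_n|}\mathsf N(B,x,F_n)=2^{-|K|}$ for every nonempty finite $K\subset G$ and every $B\in\{0,1\}^K$. *)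

(* Defs.v *)
From HB Require Import structures.
From mathcomp Require Import all_boot all_order all_algebra finmap.
From mathcomp Require Import all_classical all_reals all_analysis.

Set Implicit Arguments.
Unset Strict Implicit.
Unset Printing Implicit Defensive.

Import Order.TTheory GRing.Theory Num.Theory.
Import numFieldNormedType.Exports.

Local Open Scope fset_scope.
Local Open Scope classical_set_scope.
Local Open Scope ring_scope.

Section BaireCategory.
Variable T : topologicalType.
Implicit Types A : set T.

Definition nowhere_dense A := interior (closure A) = set0.

Definition first_category A :=
  exists2 A_ : nat -> set T,
    (forall i, nowhere_dense (A_ i)) & A = \bigcup_i A_ i.

End BaireCategory.

Section Semigroup.
Variable G : semigroupType.
Implicit Types (F K : {fset G}).

Definition cancellative :=
  (forall a b c : G, (a * b = a * c)%g -> b = c) /\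
  (forall a b c : G, (b * a = c * a)%g -> b = c).

Definition countably_infinite := ([set: G] #= [set: nat])%card.

Definition has_identity := exists e : G, forall a : G, (e * a = a /\ a * e = a)%g.

(* A mean is a functional on the bounded functions; [m] is a total function
   and its values at unbounded functions are irrelevant. *)
Record left_invariant_mean (R : realType) (m : (G -> R) -> R) : Prop := {
  mean_add : forall f1 f2 : G -> R, bounded_fun f1 -> bounded_fun f2 ->
    m (fun h => f1 h + f2 h) = m f1 + m f2;
  mean_scale : forall (c : R) (f : G -> R), bounded_fun f ->
    m (fun h => c * f h) = c * m f;
  mean_ge0 : forall f : G -> R, bounded_fun f ->
    (forall h, 0 <= f h) -> 0 <= m f;
  mean_one : m (fun=> 1) = 1;
  mean_invariant : forall (g : G) (f : G -> R), bounded_fun f ->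
    m (fun h => f (g * h)%g) = m f }.

Definition left_amenable (R : realType) :=
  exists m : (G -> R) -> R, left_invariant_mean m.

Definition left_folner (R : realType) (F : nat -> {fset G}) :=
  (forall n, F n != fset0) /\
  forall g : G,
    (#|` [fset h in F n | (g * h)%g \in F n] |%:R / #|` F n|%:R : R)
      @[n --> \oo] --> (1 : R).

(* [G] with a formal identity [None] adjoined only if [G] has no identity. *)
Definition with_identity : set (option G) :=
  [set g | g = None -> ~ has_identity].

Definition omul (h : G) (g : option G) : G :=
  if g is Some g' then (h * g')%g else h.

Definition occurrences K (B : K -> bool) (x : G -> bool) F : set (option G) :=
  [set g | with_identity g /\
    forall h : K, omul (val h) g \in F /\ x (omul (val h) g) = B h].

Lemma finite_occurrences K (B : K -> bool) (x : G -> bool) F :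
  cancellative -> K != fset0 -> finite_set (occurrences B x F).
Proof.
move=> [cl _] /fset0Pn[k kK].
have fin : finite_set [set g : G | (k * g)%g \in F].
  have -> : [set g : G | (k * g)%g \in F] = (fun g => k * g)%g @^-1` [set` F].
    by [].
  by apply: finite_preimage => [a b _ _|]; [exact: cl|exact: finite_fset].
apply: (@sub_finite_set _ _ ([set None] `|` Some @` [set g | (k * g)%g \in F])).
  move=> [g|] [_ /(_ [` kK])[/= gF _]]; last by left.
  by right; exists g.
by rewrite finite_setU; split; [exact: finite_set1|exact: finite_image].
Qed.

(* [fset_set] sends infinite sets to the empty one; by [finite_occurrences] this
   case does not arise for cancellative [G] and nonempty [K]. *)
Definition N K (B : K -> bool) (x : G -> bool) F : nat :=
  #|` fset_set (occurrences B x F) |.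

Definition normal_elements (R : realType) (F : nat -> {fset G}) :
    set {ptws G -> bool} :=
  [set x | forall K, K != fset0 -> forall B : K -> bool,
    ((N B x (F n))%:R / #|` F n|%:R : R) @[n --> \oo] --> (2 ^- #|` K| : R)].

End Semigroup.

(* Main.v *)
Require Import Defs.
From mathcomp Require Import all_boot all_order all_algebra finmap.
From mathcomp Require Import all_classical all_reals all_analysis.
From mathcomp Require Import lra.

Set Implicit Arguments.
Unset Strict Implicit.
Unset Printing Implicit Defensive.

Import Order.TTheory GRing.Theory Num.Theory.
Import numFieldNormedType.Exports.

Local Open Scope fset_scope.
Local Open Scope classical_set_scope.
Local Open Scope ring_scope.

(** Looking at patterns with a single letter is enough.  Fix [k] in [G], and
    let [ones x n] be the number of occurrences in [F n] of the pattern of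
    domain [{k}] and value [true].  If [x] is normal, then
    [ones x n / #|F n|] tends to 1/2, so from some [m] on it is at most 3/4.
    The normal elements are thus covered by the countably many sets
    [balanced m = {x | ones x n <= 3/4 #|F n| for all n >= m}], and each
    of them is nowhere dense.

    It is closed because [ones x n] depends only on the restriction of [x] to
    the finite set [F n] ([N_local]).  It has empty interior because a
    neighbourhood restricts only finitely many coordinates, those in some [S]
    ([cylinder_nbhs]), and so contains a [y] with value [true] off [S].  For
    this [y], every [h] such that [h] and [k * h] lie in [F n] is an occurrence,
    except for at most [#|S|] of them ([N_single_ge]).  The Folner
    condition at [k] makes the number of these [h] asymptotic to [#|F n|], and
    [#|F n|] tends to infinity because [G] is infinite
    ([folner_card_unbounded]), so [#|S|] is negligible: the frequency
    of [true] in [y] tends to 1 and exceeds 3/4 for all large [n]. *)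

Section Cylinders.
Variables (I : choiceType) (D : discreteTopologicalType).
Implicit Types (x y : {ptws I -> D}) (S : {fset I}).

Definition cylinder S x : set {ptws I -> D} :=
  [set y : {ptws I -> D} | {in S, (y : I -> D) =1 x}].

Lemma nbhs_cylinder S x : nbhs x (cylinder S x).
Proof.
have near1 i : nbhs x [set y : {ptws I -> D} | y i = x i].
  exact: (@proj_continuous _ (fun=> D) i x _ (discrete_set1 (x i))).
have: nbhs x (\bigcap_(i in [set` S]) [set y : {ptws I -> D} | y i = x i]).
  by apply: filter_bigI => i _; exact: near1.
by apply: filterS => y yx i iS; exact: yx.
Qed.

(** The cylinders around [x] generate a filter; it converges to [x] because the
    product topology is a supremum of the topologies induced by the
    coordinates, and each coordinate is eventually constant along it. *)
Lemma cylinder_nbhs x (U : set {ptws I -> D}) :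
  nbhs x U -> exists S, cylinder S x `<=` U.
Proof.
pose cyl := filter_from [set: {fset I}] (fun S => cylinder S x).
have Fcyl : Filter cyl.
  apply: filter_from_filter; first by exists fset0.
  move=> S1 S2 _ _; exists (S1 `|` S2)%fset => // y yx.
  by split=> i iS; apply: yx; rewrite inE iS ?orbT.
suff cylx : cyl --> x by move=> /cylx[S _ SU]; exists S.
apply/cvg_sup => i U' [_ [[B _ <-] Bx BU]].
exists [fset i] => // y yx; apply: BU => /=.
by rewrite yx ?inE.
Qed.

End Cylinders.

Section Folner.
Variables (R : realType) (G : semigroupType) (F : nat -> {fset G}).
Hypothesis folnerF : left_folner R F.

Lemma folner_card_gt0 n : (0 < #|` F n|%:R :> R).
Proof. by rewrite ltr0n cardfs_gt0 folnerF.1. Qed.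

Lemma folner_near (g : G) (eps : R) : 0 < eps ->
  \forall n \near \oo,
    (1 - eps) * #|` F n|%:R < #|` [fset h in F n | (g * h)%g \in F n]|%:R.
Proof.
move=> eps0; have := folnerF.2 g.
move=> /cvgr_gt /(_ (1 - eps)); rewrite ltrBlDr ltrDl => /(_ eps0).
apply: filterS => n; rewrite ltr_pdivlMr //; exact: folner_card_gt0.
Qed.

(** A set of bounded size that is nearly invariant under [g] is exactly
    invariant, since the proportion of its points that leave it is a multiple
    of the inverse of its size.  So if [#|F n| < M] for some large [n], then
    [F n] is invariant under [M] given elements, and these send one point
    of [F n] to [M] distinct points of it. *)
Lemma folner_card_unbounded (M : nat) :
  infinite_set [set: G] -> (forall a b c : G, (b * a = c * a)%g -> b = c) ->
  \forall n \near \oo, (M <= #|` F n|)%N.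
Proof.
move=> Ginf mulIg.
have [C _ MC] := infinite_set_fset M Ginf.
have M1 : 0 < M.+1%:R^-1 :> R by rewrite invr_gt0.
have : \forall n \near \oo, forall g, g \in C ->
    (1 - M.+1%:R^-1) * #|` F n|%:R
      < #|` [fset h in F n | (g * h)%g \in F n]|%:R :> R.
  have : \forall n \near \oo, (\bigcap_(g in [set` C]) [set n |
    (1 - M.+1%:R^-1) * #|` F n|%:R
      < #|` [fset h in F n | (g * h)%g \in F n]|%:R :> R]) n.
    by apply: filter_bigI => g _; exact: folner_near.
  by apply: filterS => n nC g gC; exact: nC.
apply: filterS => n nC; rewrite leqNgt; apply/negP => FM.
have stable g h : g \in C -> h \in F n -> (g * h)%g \in F n.
  move=> gC hF.
  have /eqP E : [fset h in F n | (g * h)%g \in F n] == F n.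
    rewrite eqEfcard; apply/andP; split.
      by apply/fsubsetP => z; rewrite !inE => /andP[].
    (* A single escaping point costs at least [1], more than the allowed
       [#|F n| / (M + 1)]. *)
    rewrite leqNgt; apply/negP => lt.
    have := nC _ gC; rewrite mulrBl mul1r ltNge => /negP; apply.
    rewrite lerBrDr; move: lt; rewrite -(ler_nat R) -natr1.
    have : M.+1%:R^-1 * #|` F n|%:R <= 1 :> R.
      by rewrite ler_pdivrMl // mulr1 ler_nat ltnW // ltnW.
    by move=> le1; apply: le_trans; rewrite lerD2l.
  by move: hF; rewrite -{1}E !inE => /andP[].
have /fset0Pn[h hF] := folnerF.1 n.
have : (#|` [fset (g * h)%g | g in C]| <= #|` F n|)%N.
  apply: fsubset_leq_card; apply/fsubsetP => _ /imfsetP[g /= gC ->].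
  exact: stable.
rewrite card_imfset /=; last by move=> a b; exact: mulIg.
by move=> CF; have := leq_ltn_trans (leq_trans MC CF) FM; rewrite ltnn.
Qed.

End Folner.

Section Occurrences.
Variable G : semigroupType.
Implicit Types (F S K : {fset G}) (x y : G -> bool).

Lemma N_local K (B : K -> bool) x y F : {in F, x =1 y} -> N B x F = N B y F.
Proof.
move=> xy; rewrite /N; congr (#|` fset_set _|); apply/seteqP.
by split=> g [g1 gB]; split=> // h; have [hF <-] := gB h; rewrite xy.
Qed.

(** A point [h] counted on the left is an occurrence of the letter [true] as
    soon as [k * h] is not in [S], and left translation by [k] is injective, so
    it sends at most [#|S|] points into [S]. *)
Lemma N_single_ge (k : G) x F S : cancellative G ->
  (forall h, h \notin S -> x h) ->
  (#|` [fset h in F | (k * h)%g \in F]|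
     <= N (fun _ : [fset k] => true) x F + #|` S|)%N.
Proof.
move=> cG xS; set E := [fset h in F | _].
rewrite -(cardfsID [fset h in E | (k * h)%g \in S] E) addnC leq_add //.
  have <- : #|` [fset Some h | h in E `\` [fset h in E | (k * h)%g \in S]]%fset|
            = #|` E `\` [fset h in E | (k * h)%g \in S]|%fset.
    by rewrite card_imfset //; exact: Some_inj.
  apply: fsubset_leq_card; apply/fsubsetP => _ /imfsetP[h /= hE ->].
  rewrite in_fset_set; last first.
    by apply: finite_occurrences => //; apply/fset0Pn; exists k; rewrite inE.
  move: hE; rewrite !inE => /andP[+ /andP[hF khF]]; rewrite hF khF/= => khS.
  split=> // -[j jk] /=; move: (jk); rewrite inE => /eqP ->.
  by rewrite xS.
have kinj : injective (fun h : G => (k * h)%g) by move=> a b; exact: cG.1.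
set E' := (_ `&` _)%fset.
have <- : #|` [fset (k * h)%g | h in E']| = #|` E'| by rewrite card_imfset.
apply: fsubset_leq_card.
apply/fsubsetP => _ /imfsetP[h /= hE ->].
by move: hE; rewrite !inE => /andP[_ /andP[]].
Qed.

End Occurrences.

Theorem proposition4p7 (R : realType) (G : semigroupType)
  (F : nat -> {fset G}) :
  countably_infinite G -> cancellative G -> left_amenable G R ->
  left_folner R F ->
  first_category (normal_elements R F).
Proof.
move=> Gcount cG _ folnerF.
have Ginf : infinite_set [set: G].
  by move=> Gfin; apply: infinite_nat; rewrite -(eq_finite_set Gcount).
have [k _] : [set: G] !=set0.
  by apply/set0P; apply/eqP => G0; apply: Ginf; rewrite G0.
pose ones (x : G -> bool) n := N (fun _ : [fset k] => true) x (F n).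
pose balanced m : set {ptws G -> bool} :=
  [set x | forall n, (m <= n)%N -> (ones x n)%:R <= 3 / 4 * #|` F n|%:R :> R].
exists (fun m => normal_elements R F `&` balanced m); last first.
  rewrite -setI_bigcupr; apply/esym/setIidPl => x xnormal.
  have k0 : [fset k] != fset0 by apply/fset0Pn; exists k; rewrite inE.
  have := xnormal _ k0 (fun=> true).
  have half : (2 ^- #|` [fset k]| < 3 / 4 :> R) by rewrite cardfs1; lra.
  move=> /cvgr_lt /(_ _ half) [m _ xm]; exists m => // n mn.
  have /ltW := xm _ mn.
  by rewrite ler_pdivrMr //; exact: folner_card_gt0 folnerF n.
move=> m; apply/eqP/negPn/negP => /set0P[x /cylinder_nbhs[S SU]].
pose y : {ptws G -> bool} := fun h => (h \in S) ==> x h.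
have /SU yclosure : cylinder S x y by move=> h hS; rewrite /y hS.
near \oo => n.
(* [y] is only in the closure of [balanced m], but an element [z] of
   [balanced m] that agrees with [y] on [F n] has the same count there. *)
have [z [[_ zbal] zy]] := yclosure _ (nbhs_cylinder (F n) y).
have ones_le : (ones y n)%:R <= 3 / 4 * #|` F n|%:R :> R.
  have -> : ones y n = ones z n by apply: N_local => h hF; rewrite zy.
  by apply: zbal; near: n; exact: nbhs_infty_ge.
have y1 h : h \notin S -> y h by rewrite /y; case: (h \in S).
have := N_single_ge k (F n) cG y1; rewrite -(ler_nat R) natrD => ones_ge.
(* The two losses, [1/8] each, leave more than [3/4] of [F n]. *)
have E_gt : (1 - 1 / 8) * #|` F n|%:R
    < #|` [fset h in F n | (k * h)%g \in F n]|%:R :> R.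
  by near: n; apply: folner_near => //; lra.
have S_le : 8 * #|` S|%:R <= #|` F n|%:R :> R.
  rewrite -natrM ler_nat; near: n.
  by apply: folner_card_unbounded folnerF _ Ginf _ => a b c; exact: cG.2.
have := lt_le_trans E_gt ones_ge.
rewrite -/(ones y n); move: ones_le S_le.
set a := (ones y n)%:R; set b := #|` F n|%:R; set c := #|` S|%:R.
lra.
Unshelve. all: by end_near.
Qed.
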